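(* Let $R$ be a field, and let $G$ be a finite cyclic group of order $m$ with a generator $g$. Let $x=\sum_{i=0}^{m-1}r_ig^i$ ($r_i\in R$) be a nonzero element of $RG$, and set $d=m-\operatorname{rank}(A_x)$. Then the following are equivalent. (1) $xRG=\Phi(N)$ for some subgroup $N\neq 1$ of $G$. (2) $d$ is a (positive) divisor of $m$ such that, with $e=m/d$, $$\sum_{i=0}^{e-1} r_{id+k}=0\quad\text{for all } k=0,1,\ldots,d-1,$$ and $\operatorname{rank}(A_x)=\operatorname{rank}(\tilde{A}_{x,d})$. Moreover, if these are satisfied, then $xRG=\Phi(\langle g^d\rangle)$ and $RG/xRG\cong R(G/\langle g^d\rangle)$ as $R$-algebras.
   Context: $RG$ is the group ring of $G$ over $R$. For a subgroup $N$ of $G$, $I(R,N)$ is the augmentation ideal of $RN$, i.e. the kernel of the $R$-algebra homomorphism $RN\to R$ sending every element of $N$ to $1$, and $\Phi(N)=I(R,N)RG$ is the ideal of $RG$ generated by $I(R,N)$. $\langle s\rangle$ denotes the subgroup generated by $s$. For $x=\sum_{i=0}^{m-1}r_ig^i$, $A_x$ is the $m\times m$ matrix over $R$ whose entry in row $a$ and column $b$ ($1\le a,b\le m$) is $r_c$, where $c\in\{0,\ldots,m-1\}$ and $c\equiv m+1-a-b \pmod m$; thus its first row is $(r_{m-1},r_{m-2},\ldots,r_1,r_0)$, its second row is $(r_{m-2},r_{m-3},\ldots,r_0,r_{m-1})$, and its last row is $(r_0,r_{m-1},\ldots,r_2,r_1)$. For an integer $n$ with $0<n<m$, $\tilde{A}_{x,n}$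 is the $m\times(m+1)$ matrix obtained from $A_x$ by appending on the right the column whose entry in row $m-n$ is $1$, whose entry in row $m$ is $-1$, and whose other entries are $0$. (Since $x\neq0$, one has $d<m$.) *)

(* Defs.v *)
From HB Require Import structures.
From mathcomp Require Import all_boot all_order all_fingroup all_algebra all_field.
(* Imported again so that repr is the one of quotients, not of finite groups. *)
From mathcomp Require Import generic_quotient.

Set Implicit Arguments.
Unset Strict Implicit.
Unset Printing Implicit Defensive.

Import GRing.Theory.
Local Open Scope ring_scope.

Section GroupRing.

Variables (R : fieldType) (gT : finGroupType).

(* The group ring of the whole group carried by gT; the group ring of a
   subgroup N is group_ring R (subg_of N). *)
Definition group_ring : Type := {ffun gT -> R^o}.

HB.instance Definition _ := Vector.copy group_ring {ffun gT -> R^o}.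

Implicit Types x y z : group_ring.

Definition gring (h : gT) : group_ring := [ffun k => (k == h)%:R].

Definition gring_mul x y : group_ring :=
  [ffun k => \sum_(h : gT) x h * y (h^-1 * k)%g].

Fact gring_mulA : associative gring_mul.
Proof.
move=> x y z; apply/ffunP=> k; rewrite !ffunE.
under eq_bigr => h _ do rewrite ffunE mulr_sumr.
under [RHS]eq_bigr => h _ do rewrite ffunE mulr_suml.
rewrite [RHS]exchange_big /=; apply: eq_bigr => h _.
rewrite [RHS](reindex_inj (mulgI h)) /=; apply: eq_bigr => j _.
by rewrite mulrA mulKg invMg mulgA.
Qed.

Fact gring_mul1r : left_id (gring 1%g) gring_mul.
Proof.
move=> x; apply/ffunP=> k; rewrite ffunE (bigD1 1%g) //= big1 => [|h h1].
  by rewrite ffunE eqxx mul1r addr0 invg1 mul1g.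
by rewrite ffunE (negPf h1) mul0r.
Qed.

Fact gring_mulr1 : right_id (gring 1%g) gring_mul.
Proof.
move=> x; apply/ffunP=> k; rewrite ffunE (bigD1 k) //= big1 => [|h hk].
  by rewrite ffunE mulVg eqxx mulr1 addr0.
by rewrite ffunE -eq_mulVg1 (negPf hk) mulr0.
Qed.

Fact gring_mulDl : left_distributive gring_mul +%R.
Proof.
move=> x y z; apply/ffunP=> k; rewrite !ffunE -big_split /=.
by apply: eq_bigr => h _; rewrite ffunE mulrDl.
Qed.

Fact gring_mulDr : right_distributive gring_mul +%R.
Proof.
move=> x y z; apply/ffunP=> k; rewrite !ffunE -big_split /=.
by apply: eq_bigr => h _; rewrite ffunE mulrDr.
Qed.

Fact gring1_neq0 : gring 1%g != 0.
Proof.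
by apply/eqP=> /ffunP/(_ 1%g); rewrite !ffunE eqxx => /eqP; rewrite oner_eq0.
Qed.

HB.instance Definition _ := GRing.Zmodule_isNzRing.Build group_ring
  gring_mulA gring_mul1r gring_mulr1 gring_mulDl gring_mulDr gring1_neq0.

Fact gring_scalerAl (a : R) x y : a *: (x * y) = (a *: x) * y.
Proof.
apply/ffunP=> k; rewrite !ffunE scaler_sumr.
by apply: eq_bigr => h _; rewrite ffunE scalerAl.
Qed.

HB.instance Definition _ :=
  GRing.Lmodule_isLalgebra.Build R group_ring gring_scalerAl.

Fact gring_scalerAr (a : R) x y : a *: (x * y) = x * (a *: y).
Proof.
apply/ffunP=> k; rewrite !ffunE scaler_sumr.
by apply: eq_bigr => h _; rewrite ffunE scalerAr.
Qed.

HB.instance Definition _ :=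
  GRing.Lalgebra_isAlgebra.Build R group_ring gring_scalerAr.

HB.instance Definition _ := Algebra_isFalgebra.Build R group_ring.

Lemma gringM h k : gring (h * k)%g = gring h * gring k.
Proof.
apply/ffunP=> j; rewrite !ffunE (bigD1 h) //= big1 => [|i ih].
  by rewrite !ffunE eqxx mul1r addr0 -(can2_eq (mulVKg h) (mulKg h)).
by rewrite ffunE (negPf ih) mul0r.
Qed.

Definition augmentation x : R^o := \sum_(h : gT) x h.

Fact augmentation_is_linear : linear augmentation.
Proof.
move=> a x y; rewrite /augmentation scaler_sumr -big_split /=.
by apply: eq_bigr => h _; rewrite !ffunE.
Qed.

HB.instance Definition _ := GRing.isLinear.Build R group_ring R^o *:%R
  augmentation augmentation_is_linear.

Fact augmentation_is_monoid_morphism : monoid_morphism augmentation.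
Proof.
rewrite /augmentation; split=> [|x y].
  by rewrite (bigD1 1%g) //= big1 => [|h h1];
     rewrite ffunE ?eqxx ?addr0 // (negPf h1).
under eq_bigr => k _ do rewrite ffunE.
rewrite exchange_big mulr_suml /=; apply: eq_bigr => h _.
by rewrite -mulr_sumr [in RHS](reindex_inj (mulgI h^-1%g)).
Qed.

HB.instance Definition _ := GRing.isMonoidMorphism.Build group_ring R^o
  augmentation augmentation_is_monoid_morphism.

Lemma augmentation_gring h : augmentation (gring h) = 1.
Proof.
rewrite /augmentation (bigD1 h) //= big1 => [|k kh].
  by rewrite ffunE eqxx addr0.
by rewrite ffunE (negPf kh).
Qed.

Definition augmentation_ideal : {vspace group_ring} :=
  lker (linfun augmentation).

Lemma augmentation_idealE x :
  (x \in augmentation_ideal) = (augmentation x == 0).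
Proof. by rewrite memv_ker lfunE. Qed.

Definition principal_ideal x : {vspace group_ring} :=
  (<[x]> * {:group_ring})%VS.

Lemma principal_idealP x z :
  reflect (exists y, z = x * y) (z \in principal_ideal x).
Proof.
apply: (iffP idP) => [|[y ->]]; last by rewrite memv_mul ?memv_line ?memvf.
rewrite /principal_ideal.
have /subvP sub : (<[x]> * {:group_ring} <= limg (amull x))%VS.
  apply/prodvP=> _ v /vlineP[a ->] _; rewrite -scalerAl scalerAr.
  by rewrite -[x * _]/((x \*o @idfun group_ring) _) -lfunE memv_img ?memvf.
by case/sub/memv_imgP=> y _ ->; exists y; rewrite lfunE.
Qed.

End GroupRing.

Section Phi.

Variables (R : fieldType) (gT : finGroupType) (N : {group gT}).

Definition gring_incl (y : group_ring R (subg_of N)) : group_ring R gT :=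
  \sum_(h : subg_of N) y h *: gring R (sgval h).

Fact gring_incl_is_linear : linear gring_incl.
Proof.
move=> a x y; rewrite /gring_incl scaler_sumr -big_split /=.
by apply: eq_bigr => h _; rewrite !ffunE scalerDl scalerA.
Qed.

HB.instance Definition _ := GRing.isLinear.Build R (group_ring R (subg_of N))
  (group_ring R gT) *:%R gring_incl gring_incl_is_linear.

(* The product of subspaces is the span of the products of their elements; this
   right ideal is two-sided when gT is abelian. *)
Definition Phi : {vspace group_ring R gT} :=
  (linfun gring_incl @: augmentation_ideal R (subg_of N) * fullv)%VS.

End Phi.

Section QuotientAlgebra.

Variables (K : fieldType) (A : falgType K).

Definition proper_two_sided_ideal (I : {vspace A}) : bool :=
  [&& (fullv * I <= I)%VS, (I * fullv <= I)%VS & 1 \notin I].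

Variables (I : {vspace A}) (hI : proper_two_sided_ideal I).

(* The proof is an argument so that the algebra structure below can be found
   from the type alone. *)
Definition quotient_algebra & proper_two_sided_ideal I : Type :=
  {ideal_quot (pred_of_vspace I)}.

Local Notation Q := (quotient_algebra hI).
Local Open Scope quotient_scope.

HB.instance Definition _ :=
  ZmodQuotient.copy Q {ideal_quot (pred_of_vspace I)}.

Fact qalg_memMl a u : u \in I -> a * u \in I.
Proof. by case/and3P: hI => /prodvP h _ _; apply: h; rewrite memvf. Qed.

Fact qalg_memMr a u : u \in I -> u * a \in I.
Proof. by case/and3P: hI => _ /prodvP h _ uI; apply: h; rewrite ?memvf. Qed.

Fact qalg_piP (u v : A) : reflect (\pi_Q u = \pi_Q v) (u - v \in I).
Proof.
rewrite (Quotient.idealrBE (pred_of_vspace I : zmodClosed A)); exact: eqP.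
Qed.

Lemma qalg_repr (u : A) : repr (\pi_Q u) - u \in I.
Proof. by apply/qalg_piP; rewrite reprK. Qed.

Definition qalg_one : Q := \pi_Q 1.
Definition qalg_mul (p q : Q) : Q := \pi_Q (repr p * repr q).
Definition qalg_scale (a : K) (p : Q) : Q := \pi_Q (a *: repr p).

Fact qalg_pi_mul (u v : A) : qalg_mul (\pi_Q u) (\pi_Q v) = \pi_Q (u * v).
Proof.
apply/qalg_piP; rewrite -[X in X - _](subrK (u * repr (\pi_Q v))) -addrA.
rewrite -mulrBl -mulrBr.
by apply: memvD; [apply: qalg_memMr | apply: qalg_memMl]; apply: qalg_repr.
Qed.

Fact qalg_pi_scale a (u : A) : qalg_scale a (\pi_Q u) = \pi_Q (a *: u).
Proof. by apply/qalg_piP; rewrite -scalerBr memvZ ?qalg_repr. Qed.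

Fact qalg_pi_add (u v : A) : \pi_Q u + \pi_Q v = \pi_Q (u + v).
Proof. exact/esym/(Quotient.pi_add (pred_of_vspace I : zmodClosed A)). Qed.

Fact qalg_mulA : associative qalg_mul.
Proof.
elim/quotW=> u; elim/quotW=> v; elim/quotW=> w.
by rewrite (qalg_pi_mul v w) (qalg_pi_mul u v) !qalg_pi_mul mulrA.
Qed.

Fact qalg_mul1r : left_id qalg_one qalg_mul.
Proof. by elim/quotW=> u; rewrite (qalg_pi_mul 1 u) mul1r. Qed.

Fact qalg_mulr1 : right_id qalg_one qalg_mul.
Proof. by elim/quotW=> u; rewrite (qalg_pi_mul u 1) mulr1. Qed.

Fact qalg_mulDl : left_distributive qalg_mul +%R.
Proof.
elim/quotW=> u; elim/quotW=> v; elim/quotW=> w.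
by rewrite (qalg_pi_add u v) (qalg_pi_mul u w) (qalg_pi_mul v w) qalg_pi_add qalg_pi_mul mulrDl.
Qed.

Fact qalg_mulDr : right_distributive qalg_mul +%R.
Proof.
elim/quotW=> u; elim/quotW=> v; elim/quotW=> w.
by rewrite (qalg_pi_add v w) (qalg_pi_mul u v) (qalg_pi_mul u w) qalg_pi_add qalg_pi_mul mulrDr.
Qed.

Fact qalg_one_neq0 : qalg_one != 0.
Proof.
have pi0 : \pi_Q 0 = 0 by exact: pi_zeror.
apply/eqP; rewrite -pi0 => eq10; have := introT (qalg_piP 1 0) eq10.
by rewrite subr0; case/and3P: hI => _ _ /negP.
Qed.

HB.instance Definition _ := GRing.Zmodule_isNzRing.Build Q
  qalg_mulA qalg_mul1r qalg_mulr1 qalg_mulDl qalg_mulDr qalg_one_neq0.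

Fact qalg_scalerA a b (p : Q) :
  qalg_scale a (qalg_scale b p) = qalg_scale (a * b) p.
Proof.
elim/quotW: p => u.
by rewrite (qalg_pi_scale b u) (qalg_pi_scale a) (qalg_pi_scale (a * b)) scalerA.
Qed.

Fact qalg_scale1r : left_id 1 qalg_scale.
Proof. by elim/quotW=> u; rewrite qalg_pi_scale scale1r. Qed.

Fact qalg_scalerDr : right_distributive qalg_scale +%R.
Proof.
move=> a; elim/quotW=> u; elim/quotW=> v.
by rewrite (qalg_pi_add u v) (qalg_pi_scale a u) (qalg_pi_scale a v) qalg_pi_add qalg_pi_scale scalerDr.
Qed.

Fact qalg_scalerDl (p : Q) : {morph qalg_scale^~ p : a b / a + b}.
Proof.
move=> a b; elim/quotW: p => u.
by rewrite (qalg_pi_scale a u) (qalg_pi_scale b u) qalg_pi_add (qalg_pi_scale (a + b)) scalerDl.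
Qed.

HB.instance Definition _ := GRing.Zmodule_isLmodule.Build K Q
  qalg_scalerA qalg_scale1r qalg_scalerDr qalg_scalerDl.

Fact qalg_scalerAl (a : K) (p q : Q) : a *: (p * q) = (a *: p) * q.
Proof.
elim/quotW: p => u; elim/quotW: q => v.
change (qalg_scale a (qalg_mul (\pi_Q u) (\pi_Q v)) =
        qalg_mul (qalg_scale a (\pi_Q u)) (\pi_Q v)).
by rewrite (qalg_pi_mul u v) (qalg_pi_scale a u) qalg_pi_mul qalg_pi_scale scalerAl.
Qed.

HB.instance Definition _ :=
  GRing.Lmodule_isLalgebra.Build K Q qalg_scalerAl.

Fact qalg_scalerAr (a : K) (p q : Q) : a *: (p * q) = p * (a *: q).
Proof.
elim/quotW: p => u; elim/quotW: q => v.
change (qalg_scale a (qalg_mul (\pi_Q u) (\pi_Q v)) =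
        qalg_mul (\pi_Q u) (qalg_scale a (\pi_Q v))).
by rewrite (qalg_pi_mul u v) (qalg_pi_scale a v) qalg_pi_mul qalg_pi_scale scalerAr.
Qed.

HB.instance Definition _ :=
  GRing.Lalgebra_isAlgebra.Build K Q qalg_scalerAr.

End QuotientAlgebra.

Section Matrices.

Variables (R : fieldType) (m : nat) (r : nat -> R).

(* Rows and columns are numbered from 0, so that a.+1 and b.+1 are the usual
   row and column numbers; the summand 2m keeps the natural-number
   subtraction from truncating. *)
Definition coef_mx : 'M[R]_m :=
  \matrix_(a < m, b < m) r ((m.*2 + 1 - a.+1 - b.+1) %% m)%N.

Definition coef_mx_ext (n : nat) : 'M[R]_(m, m + 1) :=
  row_mx coef_mx
    (\col_(a < m) if a.+1 == (m - n)%N then 1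
                  else if a.+1 == m then -1 else 0).

End Matrices.

(* Main.v *)
Require Import Defs.
From HB Require Import structures.
From mathcomp Require Import all_boot all_order all_fingroup all_algebra all_field.
From mathcomp Require Import cyclic generic_quotient zify.

Set Implicit Arguments.
Unset Strict Implicit.
Unset Printing Implicit Defensive.

Import GRing.Theory.
Local Open Scope ring_scope.

(** Everything follows from one description of the ideals Phi(N).  The map of
    group rings induced by G -> G/N is onto, and its kernel is exactly Phi(N)
    ([gring_map_eq0]): an element of the kernel is not changed by subtracting
    its image under a section of G -> G/N, and this rewrites it as a
    combination of differences h - h' with h and h' in the same coset of N.
    Hence Phi(N) has dimension m - |G : N| ([dim_Phi]), and RG/Phi(N) is
    R(G/N) by the first isomorphism theorem ([quotient_algebra_iso]).

    For cyclic G with generator g, the subgroup N is generated by g^n with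
    n = |G : N|, and sorting the exponents i = an + k by k shows that the
    image of x in R(G/N) has the coordinates sum_a r_(an+k), for k < n.  So
    the vanishing of these sums is membership of x in Phi(N)
    ([sum_exp_Phi]).

    On the other side, row j of A_x lists the coefficients of x g^j, from
    that of g^(m-1) down to that of 1.  Its row space is therefore xRG in
    coordinates, which gives dim xRG = rank A_x ([dim_principal_ideal]).  As
    A_x is symmetric and the additional column of the extended matrix holds
    the coefficients of g^n - 1, equality of the two ranks says that g^n - 1
    lies in xRG ([rank_coef_mx_ext]).

    If xRG = Phi(N), comparing dimensions gives d = |G : N|, and condition (2)
    collects facts about Phi(N).  Conversely, when d divides m and the sums
    vanish, xRG is contained in Phi(H) for H generated by g^d, and both
    spaces have dimension m - d, so they are equal. *)

(** * Group rings and maps between them *)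

Section GroupRingBasics.

Variables (R : fieldType) (gT : finGroupType).
Implicit Types (x y : group_ring R gT) (h k : gT).

Lemma gring_sum x : x = \sum_(h : gT) x h *: gring R h.
Proof.
apply/ffunP=> k; rewrite sum_ffunE (bigD1 k) //= big1 => [|h hk].
  by rewrite !ffunE eqxx addr0 [RHS]mulr1.
by rewrite !ffunE eq_sym (negPf hk) [LHS]mulr0.
Qed.

Lemma mulr_gringE x h k : (x * gring R h) k = x (k * h^-1)%g.
Proof.
rewrite ffunE (bigD1 (k * h^-1)%g) //= big1 => [|j jk].
  by rewrite ffunE invMg invgK mulgKV eqxx mulr1 addr0.
rewrite ffunE; case: (_ =P h) jk => [<-|_ _]; last by rewrite mulr0.
by rewrite invMg invgK mulKVg eqxx.
Qed.

Lemma dim_group_ring : \dim {: group_ring R gT} = #|gT|.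
Proof. by rewrite dimvf /dim /= muln1. Qed.

(** The powers of c below its order are distinct, so a combination of them
    determines its coefficients; reducing i makes the lemma usable for every
    exponent. *)
Lemma gring_span_exp (c : gT) (r : nat -> R) i :
  (\sum_(j < #[c]%g) r j *: gring R (c ^+ j)%g) (c ^+ i)%g = r (i %% #[c]%g)%N.
Proof.
have ltio : (i %% #[c]%g < #[c]%g)%N by rewrite ltn_mod order_gt0.
rewrite sum_ffunE (bigD1 (Ordinal ltio)) //= big1 => [|j ji].
  by rewrite !ffunE expg_mod_order eqxx addr0 [LHS]mulr1.
rewrite !ffunE eq_expg_mod_order (modn_small (ltn_ord j)) eq_sym.
by rewrite (negPf (_ : j != (i %% _)%N :> nat)) ?[LHS]mulr0.
Qed.

End GroupRingBasics.

Section GroupRingMap.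

Variables (R : fieldType) (gT hT : finGroupType).
Variable f : {morphism [set: gT] >-> hT}.

Definition gring_map (x : group_ring R gT) : group_ring R hT :=
  \sum_(h : gT) x h *: gring R (f h).

Fact gring_map_is_linear : linear gring_map.
Proof.
move=> a x y; rewrite /gring_map scaler_sumr -big_split /=.
by apply: eq_bigr => h _; rewrite !ffunE scalerDl scalerA.
Qed.

HB.instance Definition _ := GRing.isLinear.Build R (group_ring R gT)
  (group_ring R hT) *:%R gring_map gring_map_is_linear.

Lemma gring_map_gring h : gring_map (gring R h) = gring R (f h).
Proof.
rewrite /gring_map (bigD1 h) //= big1 => [|k kh].
  by rewrite ffunE eqxx scale1r addr0.
by rewrite ffunE (negPf kh) scale0r.
Qed.

Fact gring_map_is_monoid_morphism : monoid_morphism gring_map.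
Proof.
split=> [|x y]; first by rewrite gring_map_gring morph1.
rewrite [x in LHS]gring_sum [y in LHS]gring_sum mulr_suml linear_sum /=.
rewrite [in RHS]/gring_map mulr_suml; apply: eq_bigr => h _.
rewrite -!scalerAl linearZ mulr_sumr linear_sum mulr_sumr; congr (_ *: _).
apply: eq_bigr => k _; rewrite -!scalerAr linearZ -gringM /= gring_map_gring.
by rewrite morphM ?inE // gringM.
Qed.

HB.instance Definition _ := GRing.isMonoidMorphism.Build (group_ring R gT)
  (group_ring R hT) gring_map gring_map_is_monoid_morphism.

End GroupRingMap.

(** * The kernel of the map of group rings *)

Section KernelIsPhi.

Variables (R : fieldType) (gT hT : finGroupType).
Variable f : {morphism [set: gT] >-> hT}.

Lemma gring_sub1_Phi (N : {group gT}) n (y : group_ring R gT) :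
  n \in N -> (gring R n - 1) * y \in Phi R N.
Proof.
move=> nN; apply: memv_mul; last exact: memvf.
have -> : gring R n - 1 =
    linfun (@gring_incl R gT N) (gring R (subg N n) - 1).
  rewrite lfunE raddfB /=; have inclE h : gring_incl (gring R h) = gring R (sgval h).
    rewrite /gring_incl (bigD1 h) //= big1 => [|k kh].
      by rewrite ffunE eqxx scale1r addr0.
    by rewrite ffunE (negPf kh) scale0r.
  by rewrite !inclE subgK.
by rewrite memv_img // augmentation_idealE raddfB /= !augmentation_gring subrr.
Qed.

(** Given a section s of f on its image, the sum of the x_h s(f(h)) depends only
    on the image of x, so it vanishes with that image and may be subtracted
    from x; and each h - s(f(h)) lies in Phi, because h s(f(h))^-1 lies in the
    kernel of f.  Conversely, f maps the kernel to 1, so on its group ring the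
    map acts as the augmentation. *)
Lemma gring_map_eq0 (x : group_ring R gT) :
  (gring_map f x == 0) = (x \in Phi R ('ker f)%G).
Proof.
apply/eqP/idP=> [fx0|].
  pose s (k : hT) : gT := odflt 1%g [pick h | f h == k].
  have fs h : f (s (f h)) = f h.
    by rewrite /s; case: pickP => [k /eqP //|/(_ h)]; rewrite eqxx.
  (* This sum is obtained from the image of x by extending s linearly. *)
  have sx0 : \sum_(h : gT) x h *: gring R (s (f h)) = 0.
    pose sl : group_ring R hT -> group_ring R gT :=
      fun y => \sum_(k : hT) y k *: gring R (s k).
    have sl0 : sl 0 = 0 by rewrite /sl big1 // => k _; rewrite ffunE scale0r.
    rewrite -[RHS]sl0 -fx0 /sl /gring_map.
    under [RHS]eq_bigr => k _ do rewrite sum_ffunE scaler_suml.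
    rewrite [RHS]exchange_big /=; apply: eq_bigr => h _.
    rewrite (bigD1 (f h)) //= big1 => [|k kh].
      by rewrite !ffunE eqxx addr0; congr (_ *: _); rewrite [RHS]mulr1.
    by rewrite !ffunE (negPf kh) scaler0 scale0r.
  have -> : x = \sum_(h : gT) x h *: (gring R h - gring R (s (f h))).
    under eq_bigr => h _ do rewrite scalerBr.
    by rewrite sumrB -gring_sum sx0 subr0.
  rewrite rpred_sum // => h _; rewrite memvZ //.
  have -> : gring R h - gring R (s (f h)) =
      (gring R (h * (s (f h))^-1)%g - 1) * gring R (s (f h)).
    by rewrite mulrBl mul1r -gringM mulgKV.
  by apply: gring_sub1_Phi; rewrite !inE /= morphM ?morphV ?inE // fs mulgV.
have /subvP sub : (Phi R ('ker f)%G <= lker (linfun (gring_map f)))%VS.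
  apply/prodvP=> _ y /memv_imgP[z + ->] _.
  rewrite augmentation_idealE memv_ker !lfunE /= rmorphM /= => /eqP z0.
  suff -> : gring_map f (gring_incl z) = (augmentation z : R) *: 1.
    by rewrite z0 scale0r mul0r.
  rewrite /gring_incl /augmentation linear_sum scaler_suml.
  apply: eq_bigr => h _.
  by rewrite linearZ /= gring_map_gring (mker (subgP h)).
by move/sub; rewrite memv_ker lfunE => /eqP.
Qed.

Hypothesis fsurj : (f @* [set: gT])%g = [set: hT].

Lemma gring_map_surj (y : group_ring R hT) : exists x, gring_map f x = y.
Proof.
have fs k : {h | f h == k}.
  apply: sigW; have: k \in (f @* [set: gT])%g by rewrite fsurj inE.
  by case/morphimP=> h _ _ ->; exists h.
exists (\sum_(k : hT) y k *: gring R (sval (fs k))).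
rewrite linear_sum [RHS]gring_sum; apply: eq_bigr => k _.
by rewrite linearZ /= gring_map_gring (eqP (svalP (fs k))).
Qed.

Lemma dim_Phi_ker : (\dim (Phi R ('ker f)%G) + #|hT| = #|gT|)%N.
Proof.
have := limg_ker_dim (linfun (@gring_map R _ _ f)) fullv.
rewrite capfv dim_group_ring => <-; congr (_ + _)%N.
  congr (\dim _); apply/vspaceP=> x.
  by rewrite memv_ker lfunE -gring_map_eq0.
rewrite -(dim_group_ring R); congr (\dim _); apply/vspaceP=> y.
rewrite memvf; apply/esym/memv_imgP; have [x <-] := gring_map_surj y.
by exists x; rewrite ?memvf ?lfunE.
Qed.

End KernelIsPhi.

Section QuotientMap.

Variables (gT : finGroupType) (N : {group gT}).
Hypothesis nN : [set: gT] \subset ('N(N))%g.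

(** The projection onto the quotient has to land in the finite group type
    carried by G / N rather than in the type of all cosets of N, whence the
    composition with subg. *)
Definition to_quotient h := subg ([set: gT] / N)%G (coset N h).

Fact to_quotientM : {in [set: gT] &, {morph to_quotient : h k / (h * k)%g}}.
Proof.
move=> h k _ _; rewrite /to_quotient morphM ?(subsetP nN) ?inE //.
by rewrite subgM ?mem_quotient ?inE.
Qed.

Definition quotient_map := Morphism to_quotientM.

Lemma ker_quotient_map : ('ker quotient_map)%G = N.
Proof.
apply/val_inj/setP=> h; rewrite /= !inE /= -val_eqE /= subgK ?mem_quotient ?inE //.
by apply/eqP/idP=> [/coset_idr -> //|/coset_id //]; rewrite (subsetP nN) ?inE.
Qed.

Lemma quotient_map_surj : (quotient_map @* [set: gT])%g = setT.
Proof.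
apply/setP=> q; rewrite inE; have /morphimP[h _ _ qh] := subgP q.
apply/morphimP; exists h; rewrite ?inE //.
by apply: val_inj; rewrite /= subgK ?mem_quotient ?inE.
Qed.

Lemma card_quotient_sub : #|subg_of ([set: gT] / N)%G| = #|[set: gT] : N|%g.
Proof.
by rewrite -cardsT -(card_isog (isog_subg _)) card_quotient.
Qed.

End QuotientMap.

(** * The first isomorphism theorem *)

(** The kernel of a unital morphism to a nonzero algebra is automatically a
    proper two-sided ideal, so its being one is part of the conclusion. *)
Lemma quotient_algebra_iso (K : fieldType) (A : falgType K) (B : algType K)
    (phi : {lrmorphism A -> B}) (I : {vspace A}) :
    (forall u, (phi u == 0) = (u \in I)) -> (forall b, exists a, phi a = b) ->
  exists (hI : proper_two_sided_ideal I)
         (f : {lrmorphism quotient_algebra hI -> B}), bijective f.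
Proof.
move=> kerI surj.
have hI : proper_two_sided_ideal I.
  apply/and3P; split; last by rewrite -kerI rmorph1 oner_eq0.
    apply/prodvP=> a u _; rewrite -!kerI => /eqP u0; rewrite rmorphM /= u0.
    by rewrite mulr0.
  apply/prodvP=> u a; rewrite -!kerI => /eqP u0 _; rewrite rmorphM /= u0.
  by rewrite mul0r.
exists hI; pose Q := quotient_algebra hI.
pose f (q : Q) : B := phi (repr q).
have f_pi u : f (\pi_Q u)%qT = phi u.
  by apply/eqP; rewrite -subr_eq0 -raddfB kerI qalg_repr.
have f_linear : linear f.
  move=> a; elim/quotW=> u; elim/quotW=> v.
  rewrite [a *: _](qalg_pi_scale hI) [_ + _](qalg_pi_add hI) !f_pi.
  by rewrite linearP.
have f_mul : monoid_morphism f.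
  split; first by rewrite [1]/(qalg_one hI) f_pi rmorph1.
  elim/quotW=> u; elim/quotW=> v.
  by rewrite [_ * _](qalg_pi_mul hI) !f_pi rmorphM.
pose fL := GRing.isLinear.Build K Q B *:%R f f_linear.
pose fM := GRing.isMonoidMorphism.Build Q B f f_mul.
exists (HB.pack_for {lrmorphism Q -> B} f fL fM).
have sec b : {a | phi a == b} by apply: sigW; have [a <-] := surj b; exists a.
exists (fun b => \pi_Q (sval (sec b)))%qT => [|b] /=.
  elim/quotW=> u; apply/(qalg_piP hI); rewrite -kerI raddfB f_pi /=.
  by rewrite (eqP (svalP (sec _))) subrr.
by rewrite f_pi (eqP (svalP (sec b))).
Qed.

(** * Principal ideals of the group ring of a cyclic group *)

(** This turns the rank of a matrix into a dimension without choosing a basis of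
    the ambient space: the coordinates of a basis of V form a matrix with
    independent rows and with the row space of A. *)
Lemma dim_row_space (K : fieldType) (vT : vectType K) (n p : nat)
    (c : {linear vT -> 'rV[K]_n}) (V : {vspace vT}) (A : 'M[K]_(p, n)) :
    injective c ->
    (forall u, (u <= A)%MS <-> exists2 v, v \in V & u = c v) ->
  \dim V = \rank A.
Proof.
move=> c_inj rowsA; pose B := \matrix_(i < \dim V) c (vbasis V)`_i.
have mulB (w : 'rV_(\dim V)) : w *m B = c (\sum_i w 0 i *: (vbasis V)`_i).
  rewrite mulmx_sum_row linear_sum; apply: eq_bigr => i _.
  by rewrite rowK linearZ.
have /eqP <- : row_free B.
  apply: inj_row_free => w; rewrite mulB -(linear0 c) => /c_inj w0.
  by apply/rowP=> i; rewrite mxE (elimT freeP (basis_free (vbasisP V)) _ w0).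
apply/eqmx_rank/rV_eqP=> u; apply/idP/idP.
  case/submxP=> w ->; rewrite mulB; apply/rowsA; eexists; last by [].
  by rewrite rpred_sum // => i _; rewrite memvZ // vbasis_mem ?mem_nth ?size_tuple.
case/rowsA=> v /coord_vbasis-> ->; apply/submxP.
by exists (\row_i coord (vbasis V) i v); rewrite mulB; congr (c _);
  apply: eq_bigr => i _; rewrite mxE.
Qed.

Section CyclicGroupRing.

Variables (R : fieldType) (gT : finGroupType) (g : gT).
Hypothesis hg : [set: gT] = <[g]>%g.
Local Notation m := #[g]%g.

Lemma gen_exp k : exists2 i, (i < m)%N & k = (g ^+ i)%g.
Proof.
have /cycleP[i ->] : k \in <[g]>%g by rewrite -hg inE.
by exists (i %% m)%N; rewrite ?ltn_mod ?order_gt0 ?expg_mod_order.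
Qed.

Lemma gring_sum_exp (y : group_ring R gT) :
  y = \sum_(j < m) y (g ^+ j)%g *: gring R (g ^+ j)%g.
Proof.
apply/ffunP=> k; have [i lt_im ->] := gen_exp k.
by rewrite (gring_span_exp g (fun j => y (g ^+ j)%g)) modn_small.
Qed.

(** Coefficients in the order g^(m-1), ..., g, 1 of the columns of A_x. *)
Definition coef_row (z : group_ring R gT) : 'rV[R]_m :=
  \row_(b < m) z (g ^+ (m - b.+1))%g.

Fact coef_row_is_linear : linear coef_row.
Proof. by move=> a x y; apply/rowP=> b; rewrite !mxE !ffunE. Qed.

HB.instance Definition _ := GRing.isLinear.Build R (group_ring R gT)
  'rV[R]_m *:%R coef_row coef_row_is_linear.

Lemma coef_row_inj : injective coef_row.
Proof.
move=> x y /rowP xy; apply/ffunP=> k; have [i lt_im ->] := gen_exp k.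
have ltm : (m - i.+1 < m)%N by rewrite ltn_subrL order_gt0.
have := xy (Ordinal ltm); rewrite !mxE /= -subSn // subSS subKn //.
exact: ltnW.
Qed.

Variables (r : nat -> R) (x : group_ring R gT).
Hypothesis hx : x = \sum_(i < m) r i *: gring R (g ^+ i)%g.
Local Notation A := (coef_mx m r).

(** The coefficient of g^(m-1-b) in x g^j is r_(m-1-b-j), with the index taken
    modulo m. *)
Lemma coef_row_shift (j : 'I_m) : coef_row (x * gring R (g ^+ j)%g) = row j A.
Proof.
apply/rowP=> b; rewrite !mxE mulr_gringE.
have -> : (g ^+ (m - b.+1) * (g ^+ j)^-1 = g ^+ (m.*2 + 1 - j.+1 - b.+1))%g.
  apply: (mulIg (g ^+ j)%g); rewrite mulgKV -expgD.
  apply/eqP; rewrite eq_expg_mod_order.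
  have -> : (m.*2 + 1 - j.+1 - b.+1 + j = m + (m - b.+1))%N.
    by have := ltn_ord j; have := ltn_ord b; lia.
  by rewrite modnDl.
by rewrite hx gring_span_exp.
Qed.

Lemma coef_row_mul (y : group_ring R gT) :
  coef_row (x * y) = (\row_j y (g ^+ j)%g) *m A.
Proof.
rewrite [y in LHS]gring_sum_exp mulr_sumr linear_sum mulmx_sum_row.
apply: eq_bigr => j _.
by rewrite -scalerAr linearZ /= coef_row_shift mxE.
Qed.

Lemma sub_coef_mx u :
  (u <= A)%MS <-> exists2 v, v \in principal_ideal x & u = coef_row v.
Proof.
split=> [/submxP[w ->]|[_ /principal_idealP[y ->] ->]]; last first.
  by rewrite coef_row_mul submxMl.
pose wn i := if insub i is Some j then w 0 j else 0.
have wnE (j : 'I_m) : wn j = w 0 j by rewrite /wn valK.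
pose y := \sum_(j < m) wn j *: gring R (g ^+ j)%g.
exists (x * y); first by apply/principal_idealP; exists y.
rewrite coef_row_mul; congr (_ *m _); apply/rowP=> j; rewrite mxE.
by rewrite gring_span_exp modn_small // wnE.
Qed.

Lemma dim_principal_ideal : \dim (principal_ideal x) = \rank A.
Proof. exact: dim_row_space coef_row_inj sub_coef_mx. Qed.

Lemma mem_principal_ideal z :
  (z \in principal_ideal x) = (coef_row z <= A)%MS.
Proof.
apply/idP/idP=> [zx|]; first by apply/sub_coef_mx; exists z.
by case/sub_coef_mx=> v vx /coef_row_inj ->.
Qed.

(** Transposing the extended matrix turns the additional column into a row below
    the symmetric matrix A, namely the coordinate row of g^n - 1; adding a row
    preserves the rank exactly when the row lies in the row space.  The bounds
    on n keep the entries 1 and -1 in different positions. *)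
Lemma rank_coef_mx_ext n : (0 < n < m)%N ->
  (\rank A == \rank (coef_mx_ext m r n)) =
  (gring R (g ^+ n)%g - 1 \in principal_ideal x).
Proof.
case/andP=> n_gt0 lt_nm; rewrite mem_principal_ideal.
have colE : (\col_(a < m) if a.+1 == (m - n)%N then 1
    else if a.+1 == m then -1 else 0)^T = coef_row (gring R (g ^+ n)%g - 1).
  apply/rowP=> b; rewrite !mxE !ffunE.
  rewrite eq_expg_mod_order -order_dvdn /dvdn.
  have lt_bm : (m - b.+1 < m)%N by rewrite ltn_subrL order_gt0.
  rewrite !modn_small //.
  have -> : (b.+1 == (m - n)%N) = ((m - b.+1)%N == n).
    by apply/eqP/eqP=> [->|<-]; rewrite subKn // ltnW.
  have -> : (b.+1 == m) = ((m - b.+1)%N == 0)%N.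
    by rewrite subn_eq0 eqn_leq ltn_ord.
  case: eqP => [->|_]; first by rewrite (gtn_eqF n_gt0) subr0.
  by case: eqP => _ /=; rewrite ?subr0 ?sub0r.
have symA : A^T = A.
  by apply/matrixP=> a b; rewrite !mxE subnAC.
rewrite -(mxrank_tr (coef_mx_ext _ _ _)) tr_row_mx symA colE.
rewrite -addsmxE (mxrank_leqif_sup (addsmxSl _ _)) addsmx_sub submx_refl.
by [].
Qed.

End CyclicGroupRing.

(** * The ideals Phi(N) in the group ring of a cyclic group *)

(** The image of g has order d, so the exponents i = ad + k with the same k give
    the same power, and their coefficients add up. *)
Lemma gring_map_sum_exp (R : fieldType) (gT hT : finGroupType)
    (f : {morphism [set: gT] >-> hT}) (g : gT) (r : nat -> R) (e : nat) :
  let d := #[f g]%g in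
  gring_map f (\sum_(i < e * d) r i *: gring R (g ^+ i)%g) =
  \sum_(k < d) (\sum_(i < e) r (i * d + k)%N) *: gring R (f g ^+ k)%g.
Proof.
move=> d; rewrite linear_sum.
under eq_bigr => i _ do rewrite linearZ /= gring_map_gring morphX ?inE //.
rewrite -(big_mkord predT (fun i => r i *: gring R (f g ^+ i)%g)) big_nat_mul.
under [RHS]eq_bigr => k _ do rewrite scaler_suml.
rewrite big_mkord [RHS]exchange_big /=; apply: eq_bigr => i _.
rewrite -{1}[(i * d)%N]add0n big_addn mulSn addnK big_mkord.
apply: eq_bigr => k _; rewrite addnC; congr (_ *: gring R _).
apply/eqP; rewrite eq_expg_mod_order -/d modnMDl //.
Qed.

Section CyclicPhi.

Variables (R : fieldType) (gT : finGroupType) (g : gT) (N : {group gT}).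
Hypothesis hg : [set: gT] = <[g]>%g.
Local Notation m := #[g]%g.
Local Notation d := #|[set: gT] : N|%g.

Lemma cyclic_nN : [set: gT] \subset ('N(N))%g.
Proof.
by rewrite sub_abelian_norm ?subsetT // hg cycle_abelian.
Qed.

Local Notation f := (quotient_map cyclic_nN).

Lemma order_quotient_map_gen : #[f g]%g = d.
Proof.
rewrite -card_quotient_sub ?cyclic_nN // orderE -morphim_cycle ?inE // -hg.
by rewrite quotient_map_surj cardsT.
Qed.

Lemma index_dvd_order : (d %| m)%N.
Proof. by rewrite orderE -hg dvdn_indexg. Qed.

(** A cyclic group has only one subgroup of each order. *)
Lemma cyclic_subgroupE : N = <[(g ^+ d)%g]>%G.
Proof.
have sNG : N \subset <[g]>%g by rewrite -hg subsetT.
have mE : (m %/ #|N| = d)%N by rewrite orderE -hg divgS ?subsetT.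
have := cycle_sub_group (cardSg sNG); rewrite mE => /setP/(_ N).
by rewrite !inE sNG eqxx => /esym/eqP.
Qed.

Lemma Phi_gring_sub1 : gring R (g ^+ d)%g - 1 \in Phi R N.
Proof.
rewrite -[X in X \in _]mulr1 gring_sub1_Phi // {2}cyclic_subgroupE.
exact: cycle_id.
Qed.

Lemma dim_Phi : (\dim (Phi R N) + d = m)%N.
Proof.
have := dim_Phi_ker R (quotient_map_surj cyclic_nN).
by rewrite ker_quotient_map card_quotient_sub ?cyclic_nN // -cardsT hg -orderE.
Qed.

(** Membership in Phi(N) is read off in R(G/N), where the powers of the image of
    g below d are a basis. *)
Lemma sum_exp_Phi (r : nat -> R) :
  \sum_(i < m) r i *: gring R (g ^+ i)%g \in Phi R N <->
  forall k, (k < d)%N -> \sum_(i < m %/ d) r (i * d + k)%N = 0.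
Proof.
rewrite -{1}(ker_quotient_map cyclic_nN) -gring_map_eq0.
have -> : \sum_(i < m) r i *: gring R (g ^+ i)%g =
          \sum_(i < m %/ d * d) r i *: gring R (g ^+ i)%g.
  by rewrite divnK ?index_dvd_order.
rewrite -order_quotient_map_gen gring_map_sum_exp.
pose s k := \sum_(i < m %/ #[f g]%g) r (i * #[f g]%g + k)%N.
split=> [/eqP s0 k lt_kd | s0].
  have := gring_span_exp (f g) s k.
  by rewrite [X in fun_of_fin X]s0 ffunE modn_small.
by rewrite big1 // => k _; rewrite s0 ?scale0r.
Qed.

End CyclicPhi.

Theorem proposition4p5 (R : fieldType) (gT : finGroupType) (g : gT) (m : nat)
    (hg : [set: gT] = <[g]>%g) (hm : #|[set: gT]| = m)
    (r : nat -> R) (x : group_ring R gT)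
    (hx : x = \sum_(i < m) r i *: gring R (g ^+ i)%g) (hx0 : x != 0) :
  let d := (m - \rank (coef_mx m r))%N in
  let e := (m %/ d)%N in
  let H := <[(g ^+ d)%g]>%G in
  let cond1 :=
    exists2 N : {group gT}, N != 1%G & principal_ideal x = Phi R N in
  let cond2 :=
    [/\ (0 < d)%N, (d %| m)%N,
        forall k : nat, (k < d)%N -> \sum_(i < e) r (i * d + k)%N = 0
      & \rank (coef_mx m r) = \rank (coef_mx_ext m r d)] in
  (cond1 <-> cond2) /\
  (cond2 ->
     principal_ideal x = Phi R H /\
     exists (hI : proper_two_sided_ideal (principal_ideal x))
            (f : {lrmorphism quotient_algebra hI ->
                   group_ring R (subg_of ([set: gT] / H)%G)}),
       bijective f).
Proof.
have mE : m = #[g]%g by rewrite -hm hg.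
subst m; rewrite mE in hx * => {mE}.
move=> d e H cond1 cond2.
have dimx : \dim (principal_ideal x) = \rank (coef_mx #[g]%g r).
  exact: dim_principal_ideal.
have rank_gt0 : (0 < \rank (coef_mx #[g]%g r))%N.
  rewrite -dimx lt0n dimv_eq0; apply: contraNneq hx0 => xI0.
  by rewrite -memv0 -xI0; apply/principal_idealP; exists 1; rewrite mulr1.
have lt_dm : (d < #[g]%g)%N by rewrite ltn_subrL rank_gt0 order_gt0.
have indexH : (d %| #[g]%g)%N -> #|[set: gT] : H|%g = d.
  move=> dvd_dm; rewrite -divgS ?subsetT //= -[#|H|]/#[(g ^+ d)%g]%g.
  by rewrite hg orderXdiv // -orderE divnA ?mulKn ?order_gt0.
have PhiH : cond2 -> principal_ideal x = Phi R H.
  case=> d_gt0 dvd_dm sum0 _; apply/eqP.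
  have := dim_Phi R H hg; rewrite indexH // => dimPhi.
  rewrite eqEdim; apply/andP; split; last first.
    by rewrite dimx -(leq_add2r d) dimPhi subnKC // rank_leq_row.
  (* Phi(H) is an ideal, being a kernel, so it contains xRG as soon as it
     contains x. *)
  have xH : x \in Phi R H.
    by rewrite hx; apply/sum_exp_Phi=> // k; rewrite indexH //; apply: sum0.
  move: xH; rewrite -[H](ker_quotient_map (cyclic_nN H hg)) -gring_map_eq0.
  move=> /eqP fx0; apply/subvP=> _ /principal_idealP[y ->].
  by rewrite -gring_map_eq0 rmorphM /= fx0 mul0r.
split; first split.
- case=> N ntN xN.
  have dE : d = #|[set: gT] : N|%g.
    by rewrite /d -dimx xN -(dim_Phi R N hg) addKn.
  have d_gt0 : (0 < d)%N by rewrite dE indexg_gt0.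
  split=> //.
  + by rewrite dE index_dvd_order.
  + rewrite /e dE; apply/sum_exp_Phi=> //; rewrite -hx -xN.
    by apply/principal_idealP; exists 1; rewrite mulr1.
  + apply/eqP; rewrite (rank_coef_mx_ext hg hx) ?d_gt0 // xN dE.
    exact: Phi_gring_sub1.
- move=> c2; exists H; last exact: PhiH.
  case: c2 => d_gt0 dvd_dm _ _; apply: contraTneq lt_dm => H1.
  by rewrite -leqNgt -(indexH dvd_dm) H1 indexg1 /= hg.
move=> c2; split; first exact: PhiH.
have nH := cyclic_nN H hg.
apply: (@quotient_algebra_iso _ _ _ (@gring_map R _ _ (quotient_map nH))).
  by move=> u; rewrite PhiH // gring_map_eq0 ker_quotient_map.
exact: gring_map_surj (quotient_map_surj nH).
Qed.
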